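(* Let $X$ be a Hausdorff topological space and let $m$ be a $\sigma$-finite measure on the Borel sets of $X$ with full support, i.e. every non-empty open set has strictly positive measure. Let $p\in[1,\infty)$, and let $L$ be the infinitesimal generator of a strongly continuous, sub-Markovian semigroup $S=(S(t))_{t\ge 0}$ of bounded linear operators on $L^p(X,m)$ such that for every $\phi\in L^p(X,m)$ and all $t>0$ the function $S(t)\phi$ is continuous (i.e. has a continuous representative). Let $f:[0,\infty)\to[0,\infty)$ be convex and continuous on $[0,\infty)$ with $f(0)=0$, $f(s)>0$ for all $s>0$, and $\int_1^\infty \frac{1}{f(s)}\,ds<\infty$. Let $F:(0,\infty)\to(0,\infty)$, $F(t)=\int_t^\infty \frac{1}{f(s)}\,ds$, which is a bijection with inverse $F^{-1}$. Let $a\in L^p(X,m)$ be nonnegative. Assume that there are a time $T>0$ and a point $\xi\in X$ such that $$(S(T)a)(\xi)>F^{-1}(T).$$ Then the initial value problem $u'=Lu+f(u)$, $u(0)=a$, $u\ge 0$, has no global mild solution. More precisely, $T$ is an upper bound on the existence time of a mild solution: if $u$ is a mild solution in an interval $I\subseteq[0,\infty)$ with $0\in I$, then $\sup I\le T$.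
   Context: $L^p(X,m)$ is the space of (equivalence classes of) real-valued $p$-integrable functions, and $L^p_+(X,m)$ is its subset of functions that are nonnegative $m$-almost everywhere. If a class in $L^p(X,m)$ has a continuous representative, this representative is unique because $m$ has full support, and the class is identified with it; thus $(S(T)a)(\xi)$ denotes the value at $\xi$ of the continuous representative of $S(T)a$. The semigroup $S$ is sub-Markovian if for every $t>0$ and every $\phi\in L^p(X,m)$ taking values in $[0,1]$ $m$-a.e., $S(t)\phi$ also takes values in $[0,1]$ $m$-a.e. The symbol $f$ also denotes the composition operator $f(\phi):=f\circ\phi$ with domain $D(f):=\{\phi\in L^p_+(X,m): f\circ\phi\in L^p(X,m)\}$. Let $I$ be an interval of nonnegative real numbers with $0\in I$. A function $u:I\to L^p_+(X,m)$ is a mild solution in $I$ of the initial value problem $u'=Lu+f(u)$, $u(0)=a$, $u\ge 0$, if $u(t)\in D(f)$ for all $t\in I\setminus\{0\}$, $f\circ u\in L^1((0,t];L^p(X,m))$ (Bochner integrable) for every $t\in I\setminus\{0\}$, and $$u(t)=S(t)a+\int_0^t S(t-s)f(u(s))\,ds\quad\text{for every }t\in I,$$ where the integral is a Bochner integral. If $I=[0,\infty)$, then $u$ is called a global mild solution. *)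

(* Defs.v *)
From HB Require Import structures.
From mathcomp Require Import all_boot all_order all_algebra.
From mathcomp Require Import all_classical all_reals all_analysis.
From mathcomp Require Import ess_sup_inf measurable_realfun.

Set Implicit Arguments.
Unset Strict Implicit.
Unset Printing Implicit Defensive.

Import Order.TTheory GRing.Theory Num.Theory.
Import numFieldNormedType.Exports.

Local Open Scope classical_set_scope.
Local Open Scope ring_scope.

(* The library's [LspaceType mu p1] is a bare type of classes modulo equality
   almost everywhere; here it is made a normed module for the L^p norm. *)
Section Lspace_normedModType.
Context d (T : measurableType d) (R : realType).
Variables (mu : {measure set T -> \bar R}) (p : \bar R) (p1 : (1 <= p)%E).
Local Notation Lp := (LspaceType mu p1).
Local Notation Lf := (LfunType mu p1).
Implicit Types (f g : Lf) (x y z : Lp).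

Lemma ae_eq_Lnorm (f g : T -> R) :
  measurable_fun setT f -> measurable_fun setT g -> f = g %[ae mu] ->
  ('N[mu]_p[EFin \o f] = 'N[mu]_p[EFin \o g])%E.
Proof.
move=> mf mg fg; rewrite unlock /Lnorm; case: p p1 => [r r1| _|//].
- congr poweR; apply: ae_eq_integral => //.
  + apply: (measurableT_comp (measurable_poweR _)) => //.
    by apply: measurableT_comp => //; exact/measurable_EFinP.
  + apply: (measurableT_comp (measurable_poweR _)) => //.
    by apply: measurableT_comp => //; exact/measurable_EFinP.
  + by apply: filterS fg => t /= h _; rewrite h.
- case: ifPn => // _; apply: eq_ess_sup.
  by apply: filterS fg => t /= h; rewrite h.
Qed.

Lemma Lspace_repr_Lfun x : (x : T -> R) \in Lfun mu p.
Proof.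
rewrite inE; apply/andP; split; rewrite inE/=; first exact: (measurable_funPT (repr (x : {mfun_ mu, T >-> measurableTypeR R}))).
exact: Lebesgue_finite.
Qed.

Definition Lspace_repr x : Lf := Lfun_Sub p1 (Lspace_repr_Lfun x).

(* [LspaceType] uses the sigma-algebra of [measurableTypeR R], which is that of
   [R] with another display. *)
Lemma mfun_measurableTypeR_subproof f :
  (f : T -> measurableTypeR R) \in @mfun _ _ T (measurableTypeR R).
Proof. by rewrite inE; exact: (measurable_funPT (f : {mfun T >-> R})). Qed.

Definition mfun_measurableTypeR f : {mfun T >-> measurableTypeR R} :=
  mfun_Sub (mfun_measurableTypeR_subproof f).

Definition mfun_class f : {mfun_ mu, T >-> measurableTypeR R} :=
  \pi_({mfun_ mu, T >-> measurableTypeR R})%qT (mfun_measurableTypeR f).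

Lemma mfun_classE f : (mfun_class f : T -> R) = f %[ae mu].
Proof.
rewrite /mfun_class /aqEqMfun_to_fun.
set g := mfun_measurableTypeR f.
have /eqP : (repr (\pi_({mfun_ mu, T >-> measurableTypeR R})%qT g) = g
  %[mod {mfun_ mu, T >-> measurableTypeR R}])%qT by rewrite reprK.
by rewrite eqmodE => /asboolP.
Qed.

Lemma mfun_class_finite f : finite_norm mu p (mfun_class f).
Proof.
rewrite /finite_norm (ae_eq_Lnorm _ _ (mfun_classE f)).
- exact: Lfunction_finite.
- exact: (measurable_funPT (repr (mfun_class f))).
- exact: (measurable_funPT (f : {mfun T >-> R})).
Qed.

Definition Lspace_of_Lfun f : Lp :=
  HB.pack (mfun_class f)
    (isFinLebesgue.Build _ _ _ _ _ p1 _ (mfun_class_finite f)).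

Lemma Lspace_of_LfunE f : (Lspace_of_Lfun f : T -> R) = f %[ae mu].
Proof. exact: mfun_classE. Qed.

Lemma LspaceP x y : (x : T -> R) = y %[ae mu] -> x = y.
Proof.
case: x => x [[hx]]; case: y => y [[hy]] /= xy.
have {xy} exy : x = y.
  rewrite -(reprK x) -(reprK y); apply/eqP; rewrite eqmodE; exact/asboolP.
by rewrite -exy in hy *; rewrite (Prop_irrelevance hx hy).
Qed.

Lemma Lspace_reprK : cancel Lspace_repr Lspace_of_Lfun.
Proof. by move=> x; apply: LspaceP; exact: Lspace_of_LfunE. Qed.

Lemma eq_Lspace_of_Lfun f g :
  (f : T -> R) = g %[ae mu] -> Lspace_of_Lfun f = Lspace_of_Lfun g.
Proof.
move=> fg; apply: LspaceP.
apply: filterS3 (Lspace_of_LfunE f) (Lspace_of_LfunE g) fg => t /= a b c h.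
by rewrite a// b// c.
Qed.

Lemma Lspace_of_LfunK f :
  (Lspace_repr (Lspace_of_Lfun f) : T -> R) = f %[ae mu].
Proof. exact: Lspace_of_LfunE. Qed.

HB.instance Definition _ := gen_eqMixin Lp.
HB.instance Definition _ := gen_choiceMixin Lp.

Definition Lspace_zero : Lp := Lspace_of_Lfun 0.
Definition Lspace_opp x : Lp := Lspace_of_Lfun (- Lspace_repr x).
Definition Lspace_add x y : Lp :=
  Lspace_of_Lfun (Lspace_repr x + Lspace_repr y).
Definition Lspace_scale (c : R) x : Lp :=
  Lspace_of_Lfun (c *: Lspace_repr x).

Let add_of f g :
  Lspace_add (Lspace_of_Lfun f) (Lspace_of_Lfun g) = Lspace_of_Lfun (f + g).
Proof.
apply: eq_Lspace_of_Lfun.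
apply: filterS2 (Lspace_of_LfunK f) (Lspace_of_LfunK g) => t a b _.
exact: (f_equal2 +%R (a I) (b I)).
Qed.

Let opp_of f : Lspace_opp (Lspace_of_Lfun f) = Lspace_of_Lfun (- f).
Proof.
apply: eq_Lspace_of_Lfun.
by apply: filterS (Lspace_of_LfunK f) => t a _; exact: (congr1 -%R (a I)).
Qed.

Let scale_of (c : R) f :
  Lspace_scale c (Lspace_of_Lfun f) = Lspace_of_Lfun (c *: f).
Proof.
apply: eq_Lspace_of_Lfun.
by apply: filterS (Lspace_of_LfunK f) => t a _; exact: (congr1 ( *%R c) (a I)).
Qed.

Let addA : associative Lspace_add.
Proof.
move=> x y z; rewrite -(Lspace_reprK x) -(Lspace_reprK y) -(Lspace_reprK z).
by rewrite !add_of addrA.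
Qed.

Let addC : commutative Lspace_add.
Proof. by move=> x y; rewrite /Lspace_add addrC. Qed.

Let add0 : left_id Lspace_zero Lspace_add.
Proof. by move=> x; rewrite -(Lspace_reprK x) add_of add0r. Qed.

Let addN : left_inverse Lspace_zero Lspace_opp Lspace_add.
Proof. by move=> x; rewrite -(Lspace_reprK x) opp_of add_of addNr. Qed.

HB.instance Definition _ := Algebra.isZmodule.Build Lp addA addC add0 addN.

Let scaleA (a b : R) x :
  Lspace_scale a (Lspace_scale b x) = Lspace_scale (a * b) x.
Proof. by rewrite -(Lspace_reprK x) !scale_of scalerA. Qed.

Let scale1 : left_id 1 Lspace_scale.
Proof. by move=> x; rewrite -(Lspace_reprK x) scale_of scale1r. Qed.

Let scaleDr : right_distributive Lspace_scale Lspace_add.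
Proof.
move=> c x y; rewrite -(Lspace_reprK x) -(Lspace_reprK y).
by rewrite !(add_of, scale_of) scalerDr.
Qed.

Let scaleDl x : {morph Lspace_scale^~ x : a b / a + b >-> Lspace_add a b}.
Proof.
by move=> a b; rewrite -(Lspace_reprK x) !scale_of add_of scalerDl.
Qed.

HB.instance Definition _ :=
  GRing.Zmodule_isLmodule.Build R Lp scaleA scale1 scaleDr scaleDl.

Definition Lspace_norm x : R := fine ('N[mu]_p[EFin \o (x : T -> R)])%E.

Let norm_of f : Lspace_norm (Lspace_of_Lfun f) = fine ('N[mu]_p[EFin \o f])%E.
Proof.
rewrite /Lspace_norm (ae_eq_Lnorm _ _ (Lspace_of_LfunE f))//.
exact: (measurable_funPT (Lspace_repr (Lspace_of_Lfun f) : {mfun T >-> R})).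
Qed.

Let normD x y : Lspace_norm (x + y) <= Lspace_norm x + Lspace_norm y.
Proof.
rewrite -(Lspace_reprK x) -(Lspace_reprK y) [_ + _]add_of !norm_of.
exact: ler_LnormD.
Qed.

Let normZ (c : R) x : Lspace_norm (c *: x) = `|c| * Lspace_norm x.
Proof.
rewrite -(Lspace_reprK x) [_ *: _]scale_of !norm_of LnormZ fineM//.
by rewrite -finite_norm_fine.
Qed.

Let norm0_eq0 x : Lspace_norm x = 0 -> x = 0.
Proof.
rewrite -(Lspace_reprK x) norm_of => /fine_Lnormr_eq0 h.
exact: (@eq_Lspace_of_Lfun _ 0).
Qed.

HB.instance Definition _ :=
  Lmodule_isNormed.Build R Lp normD normZ norm0_eq0.

Lemma LspaceD x y : (x + y : Lp) = (x : T -> R) \+ y %[ae mu].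
Proof. exact: Lspace_of_LfunE. Qed.

Lemma LspaceZ (c : R) x : (c *: x : Lp) = c \*: (x : T -> R) %[ae mu].
Proof. exact: Lspace_of_LfunE. Qed.

Lemma Lspace_normE x : (`|x|%:E = 'N[mu]_p[EFin \o (x : T -> R)])%E.
Proof. exact: (finite_norm_fine (Lspace_repr x)). Qed.

End Lspace_normedModType.

Section bochner_integral.
Context d (T : measurableType d) (R : realType) (E : normedModType R).
Variable mu : {measure set T -> \bar R}.
Implicit Types (D : set T) (g : T -> E) (v : E).
Local Notation simple := (seq (set T * E)).

(* The list [:: (A_1, v_1); ...; (A_n, v_n)] encodes the E-valued simple
   function \1_A_1 v_1 + ... + \1_A_n v_n. *)
Definition simple_eval (s : simple) (x : T) : E := \sum_(Av <- s) \1_(Av.1) x *: Av.2.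

Definition simple_int (s : simple) : E := \sum_(Av <- s) fine (mu Av.1) *: Av.2.

Definition simple_in D (s : simple) :=
  {in s, forall Av, [/\ measurable Av.1, Av.1 `<=` D & (mu Av.1 < +oo)%E]}.

Definition strongly_measurable D g :=
  exists2 s : simple^nat, (forall n, simple_in D (s n)) &
    \forall x \ae mu, D x -> simple_eval (s n) x @[n --> \oo] --> g x.

Definition bochner_approx D g (s : simple^nat) :=
  (forall n, simple_in D (s n)) /\
  (\int[mu]_(x in D) `|g x - simple_eval (s n) x|%:E)%E @[n --> \oo] --> 0%E.

Definition bochner_integrable D g :=
  strongly_measurable D g /\ exists s, bochner_approx D g s.

Definition is_bochner_integral D g v :=
  strongly_measurable D g /\
  exists2 s, bochner_approx D g s & simple_int (s n) @[n --> \oo] --> v.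

End bochner_integral.

Section semigroup.
Context (R : realType) (E : normedModType R).
Implicit Types (S : R -> E -> E).

Record C0_semigroup S : Prop := {
  C0_linear : forall t : R, 0 <= t -> linear (S t) ;
  C0_bounded : forall t : R, 0 <= t ->
    exists M : R, forall x, `|S t x| <= M * `|x| ;
  C0_id : forall x, S 0 x = x ;
  C0_add : forall s t : R, 0 <= s -> 0 <= t ->
    forall x, S (s + t) x = S s (S t x) ;
  C0_continuous : forall x, {within `[0, +oo[, continuous (fun t => S t x)}
}.

(* L is a partial operator with domain D; its values outside D are irrelevant. *)
Definition is_generator S (D : set E) (L : E -> E) :=
  D = [set x | cvg (h^-1 *: (S h x - x) @[h --> 0^'+])] /\
  {in D, forall x, h^-1 *: (S h x - x) @[h --> 0^'+] --> L x}.

End semigroup.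

Notation borelType X := (g_sigma_algebraType (@open X)).

Definition full_support (R : realType) (X : ptopologicalType)
    (m : {measure set (borelType X) -> \bar R}) :=
  forall U : set X, open U -> U !=set0 -> (0 < m U)%E.

Section semilinear_problem.
Context (R : realType) (X : ptopologicalType).
Variables (m : {measure set (borelType X) -> \bar R}).
Variables (p : R) (p1 : (1 <= p%:E)%E).
Local Notation Lp := (LspaceType m p1).
Local Notation leb := (@lebesgue_measure R).
Implicit Types (S : R -> Lp -> Lp) (phi psi a : Lp) (f : R -> R).

Definition Lp_plus : set Lp := [set phi : Lp | \forall x \ae m, 0 <= phi x].

Definition sub_markovian S := forall (t : R) phi, 0 < t ->
  (\forall x \ae m, 0 <= phi x <= 1) -> \forall x \ae m, 0 <= S t phi x <= 1.

Definition is_continuous_repr phi (g : X -> R) :=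
  continuous g /\ g = phi %[ae m].

(* Unique when m has full support; 0 if phi has no continuous representative. *)
Definition continuous_repr phi : X -> R :=
  xget (fun=> 0) [set g | is_continuous_repr phi g].

(* On the domain phi >= 0 almost everywhere, so the values of f at negative
   reals play no role; off the domain comp_op is junk. *)
Definition comp_dom f : set Lp :=
  [set phi : Lp | Lp_plus phi /\ exists psi : Lp, psi = f \o phi %[ae m]].

Definition comp_op f phi : Lp := xget 0 [set psi : Lp | psi = f \o phi %[ae m]].

(* The equation u' = L u + f(u) enters through the semigroup S generated
   by L only. *)
Definition mild_solution S f a (I : set R) (u : R -> Lp) := [/\
  forall t, I t -> Lp_plus (u t),
  forall t, I t -> t != 0 -> comp_dom f (u t),
  forall t, I t -> t != 0 ->
    bochner_integrable leb `]0, t] (fun s => comp_op f (u s)) &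
  forall t, I t -> exists2 v,
    is_bochner_integral leb `]0, t] (fun s => S (t - s) (comp_op f (u s))) v &
    u t = S t a + v].

End semilinear_problem.

Section tail_integral.
Context (R : realType).
Implicit Type f : R -> R.

Definition tail_integral f (t : R) : R :=
  \int[@lebesgue_measure R]_(s in `[t, +oo[) (f s)^-1.

Definition tail_integral_inv f : R -> R :=
  'pinv_(fun=> 0) `]0, +oo[ (tail_integral f).

End tail_integral.

(* Main.v *)
Require Import Defs.
From mathcomp Require Import all_boot all_order all_algebra.
From mathcomp Require Import all_classical all_reals all_analysis.
From mathcomp Require Import measurable_realfun ring lra.

(** A mild solution [u] whose interval contains [0, T] is tested against a
    functional, and the scalar inequality so obtained is contradictory.

    By continuity, [S T a > c'] holds on a neighbourhood of [xi], for some
    [c' > F^-1(T)]. Full support and sigma-finiteness provide a set [A] of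
    finite positive measure inside that neighbourhood. Let [l] be the mean value
    over [A] and [y t := l (S (T - t) (u t))]; then [y 0 = l (S T a) >= c'].
    Applying [l \o S (T - t)] to the mild equation commutes with the Bochner
    integral ([bochner_integral_functional]) and, by the semigroup law, gives
    [y t = y 0 + \int_(]0, t]) h] with [h s = l (S (T - s) (f (u s)))], an
    integrand that is the same for all [t] ([mild_solution_functional]).

    Each [l \o S (T - s)] is positive and sends functions with values in [0, 1]
    to numbers in [0, 1]. For such functionals Jensen's inequality holds as soon
    as [f] is convex with [f 0 = 0] ([sub_markov_jensen]), so [f (y s) <= h s].
    Hence [y] is a finite supersolution of [y' = f y] on [0, T], and separation
    of variables gives [T <= F (y 0)] ([supersolution_time_le]). Since [F] is
    strictly decreasing, this contradicts [y 0 > F^-1(T)]. Working with the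
    scalar function [y] rather than with the values of [S (T - t) (u t)] at
    points of [X] avoids all questions of joint measurability.

    So [T] does not belong to [I]; as [I] is an interval containing 0, it lies
    below [T]. *)

Set Implicit Arguments.
Unset Strict Implicit.
Unset Printing Implicit Defensive.

Import Order.TTheory GRing.Theory Num.Theory.
Import numFieldNormedType.Exports.

Local Open Scope classical_set_scope.
Local Open Scope ring_scope.

(** * Convex functions on the half-line *)

Section convexity.
Context {R : realType} {f : R -> R}.
Hypothesis f_convex : convex_function (`[0, +oo[ : set R^o) f.

Lemma convex_halfline_le (t x y : R) : 0 <= t <= 1 -> 0 <= x -> 0 <= y ->
  f (t * x + (1 - t) * y) <= t * f x + (1 - t) * f y.
Proof.
move=> /andP[t0 t1] x0 y0.
pose l := @Itv01 R t t0 t1.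
by have := @f_convex l x y; rewrite !inE/= !in_itv/= !andbT; exact.
Qed.

(** The point [x] is the convex combination of [r] and [s] with weights
    [(s - x) / (s - r)] and [(x - r) / (s - r)]. *)
Lemma convex_chord_slopes (r x s : R) : 0 <= r -> r < x -> x < s ->
  (f x - f r) / (x - r) <= (f s - f x) / (s - x).
Proof.
move=> r0 rx xs.
have xr0 : 0 < x - r by rewrite subr_gt0.
have sx0 : 0 < s - x by rewrite subr_gt0.
have sr0 : 0 < s - r by rewrite subr_gt0 (lt_trans rx).
have t01 : 0 <= (s - x) / (s - r) <= 1.
  by rewrite (divr_ge0 (ltW sx0) (ltW sr0))/= ler_pdivrMr// mul1r lerB// ltW.
have := @convex_halfline_le _ r s t01 r0.
have s0 : 0 <= s by rewrite (le_trans r0)// ltW// (lt_trans rx).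
move=> /(_ s0).
have -> : (s - x) / (s - r) * r + (1 - (s - x) / (s - r)) * s = x.
  by field; rewrite gt_eqF.
have -> : (s - x) / (s - r) * f r + (1 - (s - x) / (s - r)) * f s =
  ((s - x) * f r + (x - r) * f s) / (s - r) by field; rewrite gt_eqF.
rewrite ler_pdivlMr// => h.
rewrite ler_pdivrMr// mulrAC ler_pdivlMr//.
nra.
Qed.

(** The slope [k] is the supremum of the slopes of the chords ending at [x]
    from the left, which the slope of any chord starting at [x] bounds. *)
Lemma convex_supporting_line (x : R) : 0 < x ->
  exists k, forall r, 0 <= r -> f x + k * (r - x) <= f r.
Proof.
move=> x0.
pose slopes := [set (f x - f r) / (x - r) | r in `[0, x[].
have slopes_le s : x < s -> ubound slopes ((f s - f x) / (s - x)).
  move=> xs y [r /=]; rewrite in_itv/= => /andP[r0 rx] <-.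
  exact: convex_chord_slopes.
have slopes0 : slopes !=set0.
  by exists ((f x - f 0) / (x - 0)), 0 => //=; rewrite in_itv/= lexx.
have slopesb : has_sup slopes.
  split=> //; exists ((f (x + 1) - f x) / (x + 1 - x)).
  by apply: slopes_le; rewrite ltrDl.
exists (sup slopes) => r r0.
have [rx|xr|->] := ltgtP r x; last by rewrite subrr mulr0 addr0.
- have : (f x - f r) / (x - r) <= sup slopes.
    by apply: sup_upper_bound => //; exists r => //=; rewrite in_itv/= r0.
  rewrite ler_pdivrMr ?subr_gt0//; nra.
- have : sup slopes <= (f r - f x) / (r - x).
    by apply: ge_sup => //; exact: slopes_le.
  rewrite ler_pdivlMr ?subr_gt0//; nra.
Qed.

(** Since [f 0 = 0], convexity between 0 and [s] gives [f r <= (r / s) * f s]. *)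
Lemma convex_nondecreasing : f 0 = 0 -> (forall r, 0 <= r -> 0 <= f r) ->
  forall r s, 0 <= r -> r <= s -> f r <= f s.
Proof.
move=> f0 f_ge0 r s r0 rs.
have [s0|s_gt0] := leP s 0.
  by have -> : r = s by apply/le_anti; rewrite rs (le_trans s0).
have t1 : 0 <= r / s <= 1.
  by rewrite (divr_ge0 r0 (ltW s_gt0))/= ler_pdivrMr// mul1r.
have := convex_halfline_le t1 (ltW s_gt0) (lexx 0).
rewrite mulr0 addr0 f0 mulr0 addr0 divfK ?gt_eqF// => /le_trans; apply.
by case/andP: t1 => _ t1; rewrite ler_piMl// f_ge0// ltW.
Qed.

End convexity.

(** * The tail integral of 1 / f *)
Section tail_integral_theory.
Context {R : realType} {f : R -> R}.
Local Notation leb := (@lebesgue_measure R).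
Local Notation F := (tail_integral f).
Hypothesis f_nd : forall r s, 0 <= r -> r <= s -> f r <= f s.
Hypothesis f_cont : {within `[0, +oo[, continuous f}.
Hypothesis f_gt0 : forall s, 0 < s -> 0 < f s.
Hypothesis f_tail : (\int[leb]_(s in `[1%R, +oo[) ((f s)^-1)%:E < +oo)%E.

Lemma measurable_inv_tail (t : R) : 0 < t ->
  measurable_fun `[t, +oo[ (fun s => (f s)^-1).
Proof.
move=> t0; apply: subspace_continuous_measurable_fun => //.
have : {within `[t, +oo[, continuous f}.
  apply: continuous_subspaceW f_cont => x /=; rewrite !in_itv/= !andbT.
  by apply: le_trans; exact: ltW.
move=> fc; apply: (@within_continuous_comp _ _ _ _ f GRing.inv) => // y.
rewrite inE => -[x /=]; rewrite in_itv/= andbT => tx <-.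
by apply: inv_continuous; rewrite gt_eqF// f_gt0// (lt_le_trans t0).
Qed.

Lemma integrable_inv_tail (t : R) : 0 < t ->
  leb.-integrable `[t, +oo[ (EFin \o (fun s => (f s)^-1)).
Proof.
move=> t0.
have mf (s : R) : 0 < s -> measurable_fun `[s, +oo[ (EFin \o (fun s => (f s)^-1)).
  by move=> s0; apply/measurable_EFinP; exact: measurable_inv_tail.
have tail1 : leb.-integrable `[1, +oo[ (EFin \o (fun s => (f s)^-1)).
  apply/integrableP; split; first exact: mf.
  apply: le_lt_trans f_tail; rewrite le_eqVlt; apply/orP; left.
  apply/eqP/eq_integral => s.
  rewrite inE/= in_itv/= andbT => s1; rewrite ger0_norm// invr_ge0 ltW// f_gt0//.
  by rewrite (lt_le_trans _ s1).
have [t1|t1] := leP 1 t.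
  apply: integrableS tail1 => // s /=; rewrite !in_itv/= !andbT.
  exact: le_trans.
have tail2 : leb.-integrable `[t, 1[ (EFin \o (fun s => (f s)^-1)).
  apply: measurable_bounded_integrable => //.
  - by rewrite /= lebesgue_measure_itv/= lte_fin t1 -EFinD ltry.
  - apply: (measurable_funS _ _ (measurable_inv_tail t0)) => //.
    by apply: subset_itvl.
  - exists (f t)^-1; split; first exact: num_real.
    move=> M tM s /=; rewrite in_itv/= => /andP[ts _].
    have s0 := lt_le_trans t0 ts.
    rewrite ger0_norm ?invr_ge0 ?ltW ?f_gt0//; apply: le_lt_trans tM.
    by rewrite lef_pV2 ?posrE ?f_gt0// f_nd// ltW.
apply/integrableP; split; first exact: mf.
have tE : `[t, +oo[%classic = `[t, 1[ `|` `[1, +oo[ :> set R.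
  by rewrite -itv_bndbnd_setU// bnd_simp ltW.
rewrite tE ge0_integral_setU//=.
- apply: lte_add_pinfty.
    by case/integrableP : tail2.
  by case/integrableP : tail1.
- rewrite -tE; apply/measurable_EFinP/measurableT_comp => //.
  exact: measurable_inv_tail.
- apply/disj_setPS => y [/=]; rewrite !in_itv/= => /andP[_ y1].
  by rewrite andbT leNgt y1.
Qed.

Lemma tail_integral_ge0 (t : R) : 0 < t -> 0 <= F t.
Proof.
move=> t0; apply: Rintegral_ge0 => s /=; rewrite in_itv/= andbT => ts.
by rewrite invr_ge0 ltW// f_gt0// (lt_le_trans t0).
Qed.

Lemma tail_integralB (r s : R) : 0 < r -> r <= s ->
  F r - F s = \int[leb]_(x in `[r, s]) (f x)^-1.
Proof.
move=> r0 rs; rewrite /tail_integral.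
rewrite -[X in _ - X]Rintegral_itv_obnd_cbnd; last first.
  apply: integrableS (integrable_inv_tail r0) => //.
  by move=> x /=; rewrite !in_itv/= !andbT => /ltW; exact: le_trans.
rewrite -(@Rintegral_itvB _ _ (BLeft r) +oo%O s)//; last exact: integrable_inv_tail.
by rewrite opprB addrC subrK.
Qed.

Lemma tail_integralB_ge (r s : R) : 0 < r -> r <= s ->
  (s - r) / f s <= F r - F s.
Proof.
move=> r0 rs; rewrite tail_integralB//.
have -> : (s - r) / f s = \int[leb]_(x in `[r, s]) (f s)^-1.
  rewrite Rintegral_cst//= lebesgue_measure_itv/= lte_fin mulrC.
  move: rs; rewrite le_eqVlt => /predU1P[->|->//]; by rewrite ltxx subrr.
apply: le_Rintegral => //.
- apply: continuous_compact_integrable; first exact: segment_compact.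
  by apply: continuous_subspaceT => z; exact: cvg_cst.
- by apply: integrableS (integrable_inv_tail r0) => //; exact: subset_itvl.
- move=> x /=; rewrite in_itv/= => /andP[rx xs].
  have x0 := lt_le_trans r0 rx.
  by rewrite lef_pV2 ?posrE ?f_gt0 ?(lt_le_trans x0)// f_nd// ltW.
Qed.

Lemma tail_integral_small (r e : R) : 0 < r -> 0 < e ->
  exists2 s, r <= s & F s < e.
Proof.
move=> r0 e0.
have itail := integrable_inv_tail r0.
have : (\int[leb]_(x in `[r, (r + i%:R)%R]) ((f x)^-1)%:E)%E @[i --> \oo] -->
       (\int[leb]_(x in \bigcup_i `[r, (r + i%:R)%R]%classic) ((f x)^-1)%:E)%E.
  apply: ge0_nondecreasing_set_cvg_integral => //.
  - move=> i j ij; rewrite subsetEset; apply: subset_itvl.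
    by rewrite bnd_simp lerD2l ler_nat.
  - move=> i; apply: measurable_funS (measurable_int leb itail) => //.
    exact: subset_itvl.
  - move=> i x /=; rewrite in_itv/= => /andP[rx _].
    by rewrite lee_fin invr_ge0 ltW// f_gt0// (lt_le_trans r0).
rewrite -itv_bndy_bigcup_BRight => lim_int.
have Ffin : (\int[leb]_(x in `[r, +oo[) ((f x)^-1)%:E = (F r)%:E)%E.
  by rewrite /tail_integral /Rintegral fineK//; exact: (integrable_fin_num _ itail).
rewrite Ffin in lim_int.
have /fine_cvgP[_ /cvgrPdist_lt /(_ _ e0)] := lim_int.
move=> [N _ /(_ N (leqnn N))] /=.
rewrite -/(Rintegral leb _ (fun x => (f x)^-1)) -tail_integralB ?lerDl// => h.
exists (r + N%:R); first by rewrite lerDl.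
by move: h; rewrite opprB addrC subrK => /(le_lt_trans (ler_norm _)).
Qed.

(** [F] is continuous and tends to 0 at infinity, so it takes every
    positive value below [F r] to the right of [r]. *)
Lemma tail_integral_attains (r v : R) : 0 < r -> 0 < v -> v <= F r ->
  exists2 z, r <= z & F z = v.
Proof.
move=> r0 v0 vF.
have [s rs Fs] := tail_integral_small r0 v0.
have isr : leb.-integrable `[r, s] (EFin \o (fun s => (f s)^-1)).
  by apply: integrableS (integrable_inv_tail r0) => //; exact: subset_itvl.
have := parameterized_integral_continuous rs isr => pc.
have [|z] := IVT rs pc (v := F r - v).
  rewrite /parameterized_integral set_itv1 Rintegral_set1 -tail_integralB//.
  have Fsr : 0 <= F r - F s by rewrite subr_ge0 (le_trans (ltW Fs)).
  by rewrite min_l// max_r// subr_ge0 vF/= lerD2l lerN2 ltW.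
rewrite in_itv/= => /andP[rz zs].
by rewrite /parameterized_integral -tail_integralB// => /addrI/oppr_inj; exists z.
Qed.

(** As soon as [F] takes a value at least [v], it takes the value [v] by
    [tail_integral_attains], so the partial inverse is a true inverse at [v]. *)
Lemma tail_integralK (r v : R) : 0 < r -> 0 < v -> v <= F r ->
  0 < tail_integral_inv f v /\ F (tail_integral_inv f v) = v.
Proof.
move=> r0 v0 vF.
have [z rz Fz] := tail_integral_attains r0 v0 vF.
have vim : v \in F @` `]0, +oo[.
  by rewrite inE; exists z => //=; rewrite in_itv/= andbT (lt_le_trans r0).
split; last exact: pinvK.
have : `]0, +oo[%classic (tail_integral_inv f v) by apply/funS; exact/set_mem.
by rewrite /= in_itv/= andbT.
Qed.

(** Outside the range of [F] the partial inverse takes the default value 0. *)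
Lemma tail_integral_inv_ge0 (v : R) : 0 <= tail_integral_inv f v.
Proof.
have [/set_mem vim|vim] := boolP (v \in F @` `]0, +oo[).
  have : `]0, +oo[%classic (tail_integral_inv f v) by apply/funS.
  by rewrite /= in_itv/= andbT; exact: ltW.
rewrite /tail_integral_inv /pinv_ splitV /= oinv_surj; case: pselect => //= h.
by case/negP: vim; exact/mem_set.
Qed.

(** Separation of variables for the integral inequality, on a grid of step
    [h := T / n.+1] with [y_k := y (k * h)], so that [y] need not even be
    continuous. As [1 / f] is nonincreasing,
    [F y_k - F y_(k+1) >= (y_(k+1) - y_k) / f y_(k+1) >= h * f y_k / f y_(k+1)],
    which is at least [h - h * (f y_(k+1) - f y_k) / f (y 0)]. The
    increments of [f] telescope, hence
    [F (y 0) >= T - h * (f (y T) - f (y 0)) / f (y 0)], and [n] is arbitrary. *)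
Lemma supersolution_time_le (y : R -> R) (T : R) : 0 < T -> 0 < y 0 ->
  (forall s t, 0 <= s -> s < t -> t <= T -> y s + (t - s) * f (y s) <= y t) ->
  T <= F (y 0).
Proof.
move=> T0 y0 y_growth.
have y_ge t : 0 <= t -> t <= T -> y 0 <= y t.
  rewrite le_eqVlt => /predU1P[<-//|t0] tT.
  apply: le_trans (y_growth 0 t (lexx 0) t0 tT).
  by rewrite lerDl mulr_ge0 ?subr0 ?ltW ?f_gt0.
set K := (f (y T) - f (y 0)) / f (y 0).
suff H n : T - T * K / n.+1%:R <= F (y 0).
  rewrite leNgt; apply/negP => FT.
  have e0 : 0 < T - F (y 0) by rewrite subr_gt0.
  (* chosen so that the error term T * K / n.+1 is below T - F (y 0) *)
  pose n := Num.truncn (T * K / (T - F (y 0))).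
  have := H n; apply/negP; rewrite -ltNge.
  rewrite ltrBrDr -ltrBrDl ltr_pdivrMr ?ltr0n// [ltRHS]mulrC -ltr_pdivrMr//.
  exact: truncnS_gt.
pose h := T / n.+1%:R.
have h0 : 0 < h by rewrite divr_gt0.
have hn : n.+1%:R * h = T by rewrite mulrC divfK.
have step k : (k <= n.+1)%N ->
  k%:R * h - h * ((f (y (k%:R * h)) - f (y 0)) / f (y 0))
    <= F (y 0) - F (y (k%:R * h)).
  elim: k => [_|k IH kn]; first by rewrite !mul0r !subrr mul0r mulr0 subr0.
  have {}IH := IH (ltnW kn).
  have kT : k.+1%:R * h <= T by rewrite -hn ler_pM2r// ler_nat.
  have kk : k.+1%:R * h = k%:R * h + h by rewrite -natr1 mulrDl mul1r.
  have k0 : 0 <= k%:R * h by rewrite mulr_ge0// ltW.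
  have kltk : k%:R * h < k.+1%:R * h by rewrite kk ltrDl.
  have := y_growth _ _ k0 kltk kT.
  have yk0 : 0 < y (k%:R * h).
    by rewrite (lt_le_trans y0)// y_ge// (le_trans (ltW kltk)).
  have yS0 : y 0 <= y (k.+1%:R * h) by rewrite y_ge// mulr_ge0// ltW.
  have -> : k.+1%:R * h - k%:R * h = h by rewrite kk addrC addKr.
  have hkk : k.+1%:R * h - h = k%:R * h by rewrite kk addrK.
  set yk := y (k%:R * h) in IH yk0 *; set yS := y (k.+1%:R * h) in yS0 *.
  move=> ykS.
  have fk0 := f_gt0 yk0.
  have ykyS : yk <= yS by rewrite (le_trans _ ykS)// lerDl mulr_ge0 ?ltW.
  have fS0 : 0 < f yS by rewrite f_gt0// (lt_le_trans yk0).
  have f00 := f_gt0 y0.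
  have fkS : f yk <= f yS by rewrite f_nd// ltW.
  have f0S : f (y 0) <= f yS by rewrite f_nd// ltW.
  have := tail_integralB_ge yk0 ykyS.
  have : h * f yk / f yS <= (yS - yk) / f yS.
    by rewrite ler_pM2r ?invr_gt0// lerBrDl.
  have : h * (1 - (f yS - f yk) / f (y 0)) <= h * f yk / f yS.
    rewrite -mulrA ler_pM2l//.
    have -> : f yk / f yS = 1 - (f yS - f yk) / f yS by field; rewrite gt_eqF.
    by rewrite lerD2l lerN2 ler_wpM2l ?subr_ge0// lef_pV2.
  have -> : h * (1 - (f yS - f yk) / f (y 0)) =
    h - h * (f yS / f (y 0)) + h * (f yk / f (y 0)).
    by ring.
  move: IH; rewrite !mulrBl -hkk; lra.
have := step n.+1 (leqnn _); rewrite hn -/K.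
have := tail_integral_ge0 (lt_le_trans y0 (y_ge T (ltW T0) (lexx T))).
have -> : T * K / n.+1%:R = h * K by rewrite /h mulrAC.
lra.
Qed.

End tail_integral_theory.

(** * Bounded functionals and the Bochner integral *)

Record bounded_functional (R : realType) (E : normedModType R) (l : E -> R) : Prop :=
  { bounded_functional_scalar : scalar l ;
    bounded_functional_le : exists2 M : R, 0 < M & forall x, `|l x| <= M * `|x| }.

Section bounded_functional_theory.
Context {R : realType} {E : normedModType R} {l : E -> R}.
Hypothesis bl : bounded_functional l.

Lemma bounded_functional0 : l 0 = 0.
Proof.
have := bounded_functional_scalar bl (-1) 0 0.
by rewrite scaler0 addr0 mulN1r addNr.
Qed.

Lemma bounded_functionalD x y : l (x + y) = l x + l y.
Proof.
by have := bounded_functional_scalar bl 1 x y; rewrite scale1r mul1r.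
Qed.

Lemma bounded_functionalZ (c : R) x : l (c *: x) = c * l x.
Proof.
have := bounded_functional_scalar bl c x 0.
by rewrite addr0 bounded_functional0 addr0.
Qed.

Lemma bounded_functionalB x y : l (x - y) = l x - l y.
Proof. by rewrite -scaleN1r bounded_functionalD bounded_functionalZ mulN1r. Qed.

Lemma bounded_functional_continuous : continuous l.
Proof.
have [M M0 lM] := bounded_functional_le bl.
move=> x; apply/cvgrPdist_lt => e e0.
near=> z; rewrite -bounded_functionalB (le_lt_trans (lM _))//.
rewrite mulrC -ltr_pdivlMr//.
near: z; apply: cvgr_dist_lt => //.
by rewrite divr_gt0.
Unshelve. all: by end_near. Qed.

End bounded_functional_theory.

Section ae_le_integral.
Context d (T : measurableType d) (R : realType).
Variable mu : {measure set T -> \bar R}.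
Local Open Scope ereal_scope.

(** The integral of a nonnegative function is a supremum over simple functions
    below it, so monotonicity holds for all functions. This matters for Bochner
    approximations, where [`|g - s_n|] is only measurable up to a null set. *)
Lemma ge0_le_integral_nonmeasurable (D D' : set T) (h1 h2 : T -> \bar R) :
  D `<=` D' -> (forall x, D x -> 0 <= h1 x) -> (forall x, D' x -> 0 <= h2 x) ->
  (forall x, D x -> h1 x <= h2 x) ->
  \int[mu]_(x in D) h1 x <= \int[mu]_(x in D') h2 x.
Proof.
move=> DD' h10 h20 h12; rewrite !ge0_integralE//.
apply: le_ereal_sup => _ [h hh <-]; exists h => // x.
apply: le_trans (hh x) _; rewrite !patchE.
case: ifPn => [/set_mem Dx|_]; first by rewrite mem_set ?h12//; exact: DD'.
by case: ifPn => [/set_mem D'x|//]; exact: h20.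
Qed.

Lemma ae_le_integral_nonmeasurable (D : set T) (h1 h2 : T -> \bar R) :
  measurable D -> measurable_fun D h1 ->
  (forall x, D x -> 0 <= h1 x) -> (forall x, D x -> 0 <= h2 x) ->
  {ae mu, forall x, D x -> h1 x <= h2 x} ->
  \int[mu]_(x in D) h1 x <= \int[mu]_(x in D) h2 x.
Proof.
move=> mD mh1 h10 h20 [N [mN N0 h12N]].
rewrite (ge0_negligible_integral mN)//.
apply: ge0_le_integral_nonmeasurable => //.
- by move=> x [Dx _]; exact: h10.
- move=> x [Dx Nx]; apply: contrapT => h12; apply: Nx; apply: h12N => /=.
  by move=> /(_ Dx).
Qed.

End ae_le_integral.

Lemma integrable_indic_lty d (T : measurableType d) (R : realType)
    (mu : {measure set T -> \bar R}) (D A : set T) :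
  measurable D -> measurable A -> (mu A < +oo)%E ->
  mu.-integrable D (EFin \o (\1_A : T -> R)).
Proof.
move=> mD mA Aoo; apply/integrableP; split; first exact/measurable_EFinP.
under eq_integral do rewrite /= ger0_norm//.
rewrite integral_indic//; apply: le_lt_trans Aoo.
by apply: le_measure; rewrite ?inE//; exact: measurableI.
Qed.

Section bochner_functional.
Context d (T : measurableType d) (R : realType) (E : normedModType R).
Variables (mu : {measure set T -> \bar R}) (l : E -> R).
Hypothesis bl : bounded_functional l.
Implicit Types (D : set T) (g : T -> E) (s : seq (set T * E)).

Lemma simple_functional D s : measurable D -> simple_in mu D s ->
  [/\ measurable_fun setT (l \o simple_eval s),
      mu.-integrable D (EFin \o (l \o simple_eval s)) &
      \int[mu]_(x in D) l (simple_eval s x) = l (simple_int mu s)].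
Proof.
move=> mD; elim: s => [_|[A w] s IH sin].
  have -> : l \o simple_eval (Nil (set T * E)) = cst (0 : R).
    by apply/funext => x /=; rewrite /simple_eval big_nil bounded_functional0.
  split; [exact: measurable_cst| |].
    by rewrite (_ : EFin \o _ = cst 0%E)//; exact: integrable0.
  rewrite /simple_int big_nil bounded_functional0//.
  under eq_Rintegral do rewrite /simple_eval big_nil bounded_functional0//.
  by rewrite Rintegral_cst// mul0r.
have [|ms is_ intE] := IH.
  by move=> Bw Bws; apply: sin; rewrite inE Bws orbT.
have [/= mA AD muA] := sin (A, w) (mem_head _ _).
have evE x : l (simple_eval ((A, w) :: s) x) = \1_A x * l w + l (simple_eval s x).
  rewrite /simple_eval big_cons/= bounded_functionalD// bounded_functionalZ//.
have iA : mu.-integrable D (EFin \o (fun x => \1_A x * l w)).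
  apply: (@eq_integrable _ _ _ mu D mD (fun x => ((l w)%:E * (\1_A x)%:E)%E)).
    by move=> x _ /=; rewrite -EFinM mulrC.
  apply: integrableZl => //; exact: integrable_indic_lty.
have fE : l \o simple_eval ((A, w) :: s) =
    (fun x => \1_A x * l w) \+ (l \o simple_eval s).
  by apply/funext => x /=; rewrite evE.
split.
- rewrite fE; apply: measurable_funD => //; apply: measurable_funM => //.
- rewrite fE (_ : EFin \o _ = (EFin \o (fun x => \1_A x * l w))
    \+ (EFin \o (l \o simple_eval s)))//; exact: integrableD.
- under eq_Rintegral do rewrite evE.
  rewrite RintegralD// intE /simple_int big_cons/= bounded_functionalD//.
  rewrite bounded_functionalZ//; congr (_ + _).
  under eq_Rintegral do rewrite mulrC.
  rewrite RintegralZl//; last exact: integrable_indic_lty.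
  by rewrite mulrC /Rintegral integral_indic// setIidl.
Qed.

(** [l \o g] is an almost everywhere limit of measurable functions; the
    measurable representative is the upper limit, defined everywhere. *)
Lemma strongly_measurable_functional D g : measurable D ->
  strongly_measurable mu D g ->
  exists2 h : T -> R, measurable_fun D h &
    {ae mu, forall x, D x -> h x = l (g x)}.
Proof.
move=> mD [s s_in s_cvg].
pose h x := fine (limn_esup (fun n => (l (simple_eval (s n) x))%:E)).
exists h.
  apply: (measurableT_comp (fine_measurable measurableT)) => //.
  apply: measurable_fun_limn_esup => n; apply/measurable_EFinP.
  have [ms _ _] := simple_functional mD (s_in n).
  exact: measurable_funTS ms.
apply: filterS s_cvg => x /[apply] sx; rewrite /h.
have cx : (l (simple_eval (s n) x))%:E @[n --> \oo] --> (l (g x))%:E.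
  apply: cvg_EFin; first by apply: nearW.
  by apply: continuous_cvg => //; exact: bounded_functional_continuous.
by rewrite (cvg_limn_einf_sup cx).
Qed.

(** Bounded functionals commute with the Bochner integral. If [s_n] approximates
    [g] in mean, then [l \o s_n] approximates [h] in mean, since
    [`|h - l \o s_n| <= M * `|g - s_n|] almost everywhere; and on simple
    functions the claim is [simple_functional]. *)
Lemma bochner_integral_functional D g v (h : T -> R) :
  measurable D -> is_bochner_integral mu D g v ->
  measurable_fun D h -> {ae mu, forall x, D x -> h x = l (g x)} ->
  mu.-integrable D (EFin \o h) /\ \int[mu]_(x in D) h x = l v.
Proof.
move=> mD [_ [s [s_in sg] sv]] mh hg.
have [M M0 lM] := bounded_functional_le bl.
pose S n := l \o simple_eval (s n).
have mS n : measurable_fun D (S n).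
  by have [ms _ _] := simple_functional mD (s_in n); exact: measurable_funTS ms.
have iS n : mu.-integrable D (EFin \o S n).
  by have [_ is_ _] := simple_functional mD (s_in n).
have SE n : \int[mu]_(x in D) S n x = l (simple_int mu (s n)).
  by have [_ _ ->] := simple_functional mD (s_in n).
pose err n := (\int[mu]_(x in D) `|h x - S n x|%:E)%E.
have merr n : measurable_fun D (fun x => `|h x - S n x|%:E).
  apply/measurable_EFinP/measurableT_comp => //; exact: measurable_funB.
have err_le n : (err n <= M%:E * \int[mu]_(x in D) `|g x - simple_eval (s n) x|%:E)%E.
  have M_ge0 : 0 <= M^-1 by rewrite invr_ge0 ltW.
  rewrite -lee_pdivrMl// -ge0_integralZl_EFin//.
  apply: ae_le_integral_nonmeasurable => //.
  - exact: measurable_funeM.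
  - by move=> x _; rewrite mule_ge0.
  - apply: filterS hg => x /[apply] ->.
    by rewrite -EFinM lee_fin ler_pdivrMl// -bounded_functionalB.
have err0 : err n @[n --> \oo] --> 0%E.
  apply: (@squeeze_cvge _ _ _ _ (cst 0%E) _
    (fun n => M%:E * \int[mu]_(x in D) `|g x - simple_eval (s n) x|%:E)%E).
  - by apply: nearW => n; rewrite err_le andbT integral_ge0.
  - exact: cvg_cst.
  - by rewrite -(mule0 M%:E); apply: cvgeZl.
have [errfin err0r] := (fine_cvgP _ _).1 err0.
have [N _ /(_ N (leqnn N)) errN] := errfin.
have iD n : err n \is a fin_num -> mu.-integrable D (EFin \o (fun x => h x - S n x)).
  move=> fn; apply/integrableP; split.
    by apply/measurable_EFinP; exact: measurable_funB.
  by rewrite -ge0_fin_numE// integral_ge0.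
have ih : mu.-integrable D (EFin \o h).
  rewrite (_ : EFin \o h = (EFin \o (fun x => h x - S N x)) \+ (EFin \o S N)).
    by apply: integrableD => //; exact: iD.
  by apply/funext => x /=; rewrite -EFinD subrK.
split => //.
have lS : l (simple_int mu (s n)) @[n --> \oo] --> l v.
  by apply: continuous_cvg => //; exact: bounded_functional_continuous.
have hS : l (simple_int mu (s n)) @[n --> \oo] --> \int[mu]_(x in D) h x.
  apply/cvgrPdist_le => e e0.
  move/cvgrPdist_le : err0r => /(_ _ e0) err_e.
  near=> n.
  rewrite -SE -RintegralB//.
  have fn : err n \is a fin_num by near: n.
  apply: le_trans (le_normr_Rintegral mD (iD n fn)) _.
  have : `|0 - fine (err n)| <= e by near: n.
  by rewrite sub0r normrN; apply: le_trans; exact: ler_norm.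
exact: (cvg_unique _ hS lS).
Unshelve. all: by end_near. Qed.

End bochner_functional.

(** * Positive functionals on L^p *)

Section Lspace_truncation.
Context d (T : measurableType d) (R : realType).
Variables (m : {measure set T -> \bar R}) (p : R) (p1 : (1 <= p%:E)%E).
Local Notation Lp := (LspaceType m p1).

Let p_ge1 : 1 <= p. Proof. by rewrite -lee_fin. Qed.
Let p_gt0 : 0 < p. Proof. exact: lt_le_trans ltr01 p_ge1. Qed.

Lemma measurable_Lspace (x : Lp) : measurable_fun setT (x : T -> R).
Proof. exact: (measurable_funPT (Lspace_repr x : {mfun T >-> R})). Qed.

Lemma measurable_norm_powR (g : T -> R) : measurable_fun setT g ->
  measurable_fun setT (fun t => `|g t| `^ p).
Proof.
move=> mg; apply: (@measurableT_comp _ _ _ _ _ _ (@powR R ^~ p)) => //.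
exact: measurableT_comp.
Qed.

Lemma Lspace_integrable_powR (x : Lp) :
  m.-integrable setT (fun t => (`|x t| `^ p)%:E).
Proof. exact: Lfun_integrable (Lspace_repr_Lfun x). Qed.

Lemma Lspace_norm_powR (x : Lp) :
  (\int[m]_t (`|x t| `^ p)%:E = (`|x| `^ p)%:E)%E.
Proof.
rewrite -poweR_EFin Lspace_normE poweR_Lnorm ?gt_eqF//.
Qed.

Lemma LspaceB (x y : Lp) : (x - y : Lp) = (x : T -> R) \- y %[ae m].
Proof.
have := LspaceD x (- y); have := LspaceZ (-1) y; rewrite scaleN1r.
apply: filterS2 => t /(_ I) ey /(_ I) exy _.
by rewrite exy /= ey /= scaleN1r.
Qed.

Lemma Lspace_dominated (x : Lp) (g : T -> R) : measurable_fun setT g ->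
  (forall t, `|g t| <= `|x t|) -> exists y : Lp, (y : T -> R) = g %[ae m].
Proof.
move=> mg gx.
have gL : g \in Lfun m p%:E.
  rewrite inE; apply/andP; split; rewrite inE//= /finite_norm.
  apply: (@lty_poweRy _ _ p); first by rewrite gt_eqF.
  rewrite poweR_Lnorm ?gt_eqF//=.
  have /integrableP[mx] := Lspace_integrable_powR x.
  apply: le_lt_trans; apply: ge0_le_integral => //=.
  - by apply/measurable_EFinP; exact: measurable_norm_powR.
  - apply/measurable_EFinP/measurableT_comp => //.
    by apply: measurable_norm_powR; exact: measurable_Lspace.
  - move=> t _; rewrite lee_fin (ger0_norm (powR_ge0 _ _)).
    by apply: ge0_ler_powR; rewrite ?nnegrE ?(ltW p_gt0).
exists (Lspace_of_Lfun (Lfun_Sub p1 gL)); exact: Lspace_of_LfunE.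
Qed.

(** Dominated convergence: [`|h - min(h, n)| ^ p] tends to 0 and is bounded by
    the integrable function [`|h| ^ p]. *)
Lemma Lspace_truncation_cvg (h : Lp) (x : nat -> Lp) :
  (forall n, (x n : T -> R) = (fun t => Num.max 0 (Num.min (h t) n%:R)) %[ae m]) ->
  (\forall t \ae m, 0 <= h t) -> x n @[n --> \oo] --> h.
Proof.
move=> xE h0.
have mh := measurable_Lspace h.
pose g n t := h t - Num.max 0 (Num.min (h t) n%:R).
have mg n : measurable_fun setT (g n).
  apply: measurable_funB => //; apply: measurable_maxr => //.
  exact: measurable_minr.
have normE n : ((`|h - x n| `^ p)%:E = \int[m]_t (`|g n t| `^ p)%:E)%E.
  rewrite -Lspace_norm_powR; apply: ae_eq_integral => //.
  - apply/measurable_EFinP/measurable_norm_powR; exact: measurable_Lspace.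
  - by apply/measurable_EFinP/measurable_norm_powR.
  - apply: filterS2 (xE n) (LspaceB h (x n)) => t /(_ I) e1 /(_ I) e2 _.
    by rewrite e2/= e1.
have g_le n t : `|g n t| <= `|h t|.
  rewrite /g; have [ht0|ht0] := leP 0 (h t).
    have mt : 0 <= Num.min (h t) n%:R by rewrite le_min ht0 ler0n.
    rewrite (max_r mt) ger0_norm ?subr_ge0 ?ge_min ?lexx//.
    by rewrite (ger0_norm ht0) gerBl.
  by rewrite (max_l _) ?subr0// ge_min (ltW ht0).
have int_g0 : (\int[m]_t (`|g n t| `^ p)%:E)%E @[n --> \oo] --> 0%E.
  have mgp n : measurable_fun setT (fun t => (`|g n t| `^ p)%:E).
    by apply/measurable_EFinP/measurable_norm_powR.
  have g0 : {ae m, forall t, setT t -> (`|g n t| `^ p)%:E @[n --> \oo] --> 0%E}.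
    apply: filterS h0 => t ht0 _; apply: cvg_near_cst; near=> n.
    have htn : h t <= n%:R.
      by apply: ltW; rewrite -[ltLHS]ger0_norm//; near: n; exact: nbhs_infty_gtr.
    by rewrite /g min_l// max_r// subrr normr0 powR0// gt_eqF.
  have gh : {ae m, forall t n, setT t ->
      (`|(`|g n t| `^ p)%:E| <= (`|h t| `^ p)%:E)%E}.
    apply: nearW => t n _; rewrite lee_fin (ger0_norm (powR_ge0 _ _)).
    by rewrite ge0_ler_powR// ?nnegrE// ltW.
  have [_ _] := dominated_convergence measurableT mgp (measurable_cst 0%E) g0
    (Lspace_integrable_powR h) gh.
  by rewrite integral0.
have [fin_g /cvgrPdist_lt gr0] := (fine_cvgP _ _).1 int_g0.
apply/cvgrPdist_lt => e e0.
have ep : 0 < e `^ p by rewrite powR_gt0.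
near=> n.
have : `|0 - fine (\int[m]_t (`|g n t| `^ p)%:E)| < e `^ p.
  by near: n; exact: gr0.
rewrite -normE/= sub0r normrN ger0_norm ?powR_ge0//.
by rewrite !ltNge; apply: contra => ?; rewrite ge0_ler_powR// ?nnegrE// ltW.
Unshelve. all: by end_near. Qed.

Lemma Lspace_positive_part (x : Lp) : exists y : Lp,
  (y : T -> R) = (fun t => Num.max 0 (x t)) %[ae m].
Proof.
apply: (@Lspace_dominated x).
  by apply: measurable_maxr => //; exact: measurable_Lspace.
by move=> t; have [x0|x0] := leP 0 (x t); rewrite ?normr0.
Qed.

(** The scalar counterpart of a sub-Markovian operator. *)
Record sub_markov_functional (l : Lp -> R) : Prop :=
  { sub_markov_bounded : bounded_functional l ;
    sub_markov_unit : forall x : Lp, (\forall t \ae m, 0 <= x t <= 1) ->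
      0 <= l x <= 1 }.

Section sub_markov_functional_theory.
Context {l : Lp -> R}.
Hypothesis sl : sub_markov_functional l.
Let bl := sub_markov_bounded sl.

Lemma sub_markov_le (x : Lp) (c : R) : 0 < c ->
  (\forall t \ae m, 0 <= x t <= c) -> 0 <= l x <= c.
Proof.
move=> c0 xc; have -> : x = c *: (c^-1 *: x).
  by rewrite scalerA divff ?gt_eqF// scale1r.
rewrite (bounded_functionalZ bl).
have /andP[l0 l1] : 0 <= l (c^-1 *: x) <= 1.
  apply: sub_markov_unit => //.
  apply: filterS2 xc (LspaceZ c^-1 x) => t /andP[x0 xc] /(_ I) ->.
  by rewrite /= mulr_ge0 ?invr_ge0 ?(ltW c0)//= ler_pdivrMl// mulr1.
by rewrite mulr_ge0 ?(ltW c0)//= -[leRHS]mulr1 ler_pM2l.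
Qed.

(** The definition controls bounded functions only; a nonnegative [x] is the
    L^p limit of its truncations [min(x, n)], to which it applies after
    rescaling. *)
Lemma sub_markov_ge0 (x : Lp) : (\forall t \ae m, 0 <= x t) -> 0 <= l x.
Proof.
move=> x0.
have trunc n : exists y : Lp,
    (y : T -> R) = (fun t => Num.max 0 (Num.min (x t) n%:R)) %[ae m].
  apply: (@Lspace_dominated x).
    apply: measurable_maxr => //; apply: measurable_minr => //.
    exact: measurable_Lspace.
  move=> t; have [xt0|xt0] := leP 0 (x t).
    have mt : 0 <= Num.min (x t) n%:R by rewrite le_min xt0 ler0n.
    by rewrite (max_r mt) ger0_norm// (ger0_norm xt0) ge_min lexx.
  by rewrite max_l ?normr0// ge_min (ltW xt0).
pose y n := sval (cid (trunc n)).
have yE n := svalP (cid (trunc n)).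
have ly : l (y n) @[n --> \oo] --> l x.
  apply: continuous_cvg; first exact: (bounded_functional_continuous bl).
  exact: Lspace_truncation_cvg x0.
rewrite -(cvg_lim _ ly)//; apply: limr_ge; first exact: cvgP ly.
apply: nearW => n.
have /andP[] // : 0 <= l (y n) <= n.+1%:R.
apply: sub_markov_le => //.
apply: filterS (yE n) => t /(_ I) ->; rewrite le_max lexx/= ge_max ler0n/=.
by rewrite ge_min ler_nat leqnSn orbT.
Qed.

Lemma sub_markov_homo (x y : Lp) : (\forall t \ae m, x t <= y t) -> l x <= l y.
Proof.
move=> xy; rewrite -subr_ge0 -(bounded_functionalB bl); apply: sub_markov_ge0.
by apply: filterS2 xy (LspaceB y x) => t xyt /(_ I) ->; rewrite /= subr_ge0.
Qed.

(** The constant [c] need not be in L^p, so [x] cannot be compared with it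
    directly; its positive part is in L^p and takes values between 0 and [c]. *)
Lemma sub_markov_upper (x : Lp) (c : R) : 0 <= c ->
  (\forall t \ae m, x t <= c) -> l x <= c.
Proof.
move=> c0 xc.
have [y yE] := Lspace_positive_part x.
have xy : l x <= l y.
  apply: sub_markov_homo; apply: filterS yE => t /(_ I) ->.
  by rewrite le_max lexx orbT.
(* sub_markov_le needs a positive bound, while c may vanish *)
apply: (le_trans xy); apply/ler_addgt0Pr => e e0.
have ce0 : 0 < c + e by rewrite ltr_wpDl.
have /andP[] // : 0 <= l y <= c + e.
apply: sub_markov_le => //.
apply: filterS2 xc yE => t xtc /(_ I) ->.
by rewrite le_max lexx/= ge_max (ltW ce0)/= (le_trans xtc)// lerDl ltW.
Qed.

(** Jensen's inequality from a single supporting line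
    [r |-> f (l x) + k * (r - l x)] of [f] at [l x]. It gives
    [k * x - f \o x <= k * l x - f (l x)] almost everywhere, and the constant
    on the right is nonnegative because [f 0 = 0]. So [sub_markov_upper] applies
    to [k * x - f \o x], even if [l] has mass less than 1. *)
Lemma sub_markov_jensen (f : R -> R) (x y : Lp) :
  convex_function (`[0, +oo[ : set R^o) f -> f 0 = 0 ->
  (\forall t \ae m, 0 <= x t) -> (y : T -> R) = f \o x %[ae m] ->
  0 < l x -> f (l x) <= l y.
Proof.
move=> f_convex f0 x0 yE lx0.
have [k fk] := convex_supporting_line f_convex lx0.
have : l (k *: x - y) <= k * l x - f (l x).
  apply: sub_markov_upper.
    by have := fk 0 (lexx 0); rewrite f0; lra.
  have := LspaceB (k *: x) y; have := LspaceZ k x.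
  apply: filterS3 (filterI x0 yE) => t [xt0 /(_ I) yt] /(_ I) kxt /(_ I) ->.
  by rewrite /= kxt yt /= -[k *: _]/(k * _); have := fk _ xt0; lra.
rewrite (bounded_functionalB bl) (bounded_functionalZ bl); lra.
Qed.
End sub_markov_functional_theory.
End Lspace_truncation.

(** * Mean values over sets of finite measure *)

Lemma integrable_cst_lty d (T : measurableType d) (R : realType)
    (mu : {measure set T -> \bar R}) (A : set T) (c : R) :
  measurable A -> (mu A < +oo)%E -> mu.-integrable A (EFin \o cst c).
Proof.
move=> mA Aoo; apply/integrableP; split; first exact/measurable_EFinP.
under eq_integral do rewrite /=.
by rewrite integral_cst// lte_mul_pinfty.
Qed.

Lemma eq_ae_Rintegral d (T : measurableType d) (R : realType)
    (mu : {measure set T -> \bar R}) (A : set T) (g h : T -> R) :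
  measurable A -> measurable_fun A g -> measurable_fun A h ->
  {ae mu, forall t, A t -> g t = h t} ->
  \int[mu]_(t in A) g t = \int[mu]_(t in A) h t.
Proof.
move=> mA mg mh gh; congr fine; apply: ae_eq_integral => //; [exact/measurable_EFinP..|].
by apply: filterS gh => t /[apply] ->.
Qed.

Lemma Rintegral_ae_ge d (T : measurableType d) (R : realType)
    (mu : {measure set T -> \bar R}) (A : set T) (h : T -> R) (c : R) :
  measurable A -> (mu A < +oo)%E -> mu.-integrable A (EFin \o h) ->
  {ae mu, forall t, A t -> c <= h t} ->
  c * fine (mu A) <= \int[mu]_(t in A) h t.
Proof.
move=> mA Aoo ih ch; rewrite -Rintegral_cst// -subr_ge0.
have mh : measurable_fun A h by apply/measurable_EFinP; case/integrableP : ih.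
rewrite -RintegralB//; last exact: integrable_cst_lty.
rewrite (@eq_ae_Rintegral _ _ _ _ _ _ (fun t => Num.max 0 (h t - c)))//.
- by apply: Rintegral_ge0 => t _; rewrite le_max lexx.
- exact: measurable_funB.
- by apply: measurable_maxr => //; exact: measurable_funB.
- by apply: filterS ch => t /[apply] cht; rewrite max_r// subr_ge0.
Qed.

Section average.
Context d (T : measurableType d) (R : realType).
Variables (m : {measure set T -> \bar R}) (p : R) (p1 : (1 <= p%:E)%E).
Variable A : set T.
Hypotheses (mA : measurable A) (mA_gt0 : (0 < m A)%E) (mA_lty : (m A < +oo)%E).
Local Notation Lp := (LspaceType m p1).

Definition average (x : T -> R) : R := (fine (m A))^-1 * \int[m]_(t in A) x t.

Let a_gt0 : 0 < fine (m A).
Proof. by rewrite fine_gt0// mA_gt0. Qed.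

Let p_ge1 : 1 <= p. Proof. by rewrite -lee_fin. Qed.
Let p_gt0 : 0 < p. Proof. exact: lt_le_trans ltr01 p_ge1. Qed.

(** This elementary bound replaces Hoelder's inequality on sets of finite
    measure and treats [p = 1] and [p > 1] alike. *)
Lemma norm_le1D_powR (r : R) : `|r| <= 1 + `|r| `^ p.
Proof.
have [r1|r1] := leP 1 `|r|.
  by rewrite (le_trans (le1r_powR r1 p_ge1))// lerDr.
by rewrite (le_trans (ltW r1))// lerDl powR_ge0.
Qed.

Let integrable_1D_powR (x : Lp) :
  m.-integrable A (EFin \o (fun t => 1 + `|x t| `^ p)).
Proof.
rewrite (_ : _ \o _ = (EFin \o cst 1) \+ (fun t => (`|x t| `^ p)%:E)); last first.
  by apply/funext => t /=; rewrite EFinD.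
apply: integrableD => //.
  exact: integrable_cst_lty.
exact: integrableS (Lspace_integrable_powR x).
Qed.

Lemma Lspace_integrable_finite (x : Lp) : m.-integrable A (EFin \o (x : T -> R)).
Proof.
apply: le_integrable (integrable_1D_powR x) => //.
  apply/measurable_EFinP; exact: measurable_funTS (measurable_Lspace x).
move=> t _ /=; rewrite lee_fin (le_trans (norm_le1D_powR _))// ler_norm//.
Qed.

Lemma average_ge (x : Lp) (c : R) :
  {ae m, forall t, A t -> c <= x t} -> c <= average x.
Proof.
move=> cx; rewrite /average ler_pdivlMl// mulrC; apply: Rintegral_ae_ge => //.
exact: Lspace_integrable_finite.
Qed.

Lemma average_scalar : scalar (average : Lp -> R).
Proof.
move=> c x y; rewrite /average mulrCA -mulrDr; congr (_ * _).
have iE (z : Lp) := Lspace_integrable_finite z.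
have mE (z : Lp) := measurable_funTS (D := A) (measurable_Lspace z).
have icx : m.-integrable A (EFin \o (fun t => c * x t)) by exact: integrableZl (iE x).
rewrite -RintegralZl// -RintegralD//; apply: eq_ae_Rintegral => //.
  by apply: measurable_funD => //; exact: measurable_funM.
apply: filterS2 (LspaceZ c x) (LspaceD (c *: x) y) => t /(_ I) e1 /(_ I) -> _.
by rewrite /= e1.
Qed.

Let averageZ c (x : Lp) : average (c *: x : Lp) = c * average x.
Proof.
have average0 : average (0 : Lp) = 0.
  have := average_scalar (-1) 0 0.
  by rewrite scaler0 addr0 mulN1r addNr.
by have := average_scalar c x 0; rewrite addr0 average0 addr0.
Qed.

(** For boundedness, take [`|x| = 1]: integrating
    [`|x t| <= 1 + `|x t| ^ p] over [A] bounds the integral of [`|x|] on [A]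
    by [m A + 1]. The general case follows by homogeneity. *)
Lemma average_sub_markov : sub_markov_functional (average : Lp -> R).
Proof.
split; last first.
  move=> x x01; apply/andP; split.
    by apply: average_ge; apply: filterS x01 => t /andP[].
  have := averageZ (-1) x; rewrite mulN1r -lerN2 => <-; apply: average_ge.
  apply: filterS2 x01 (LspaceZ (-1) x) => t /andP[_ x1] /(_ I) -> _.
  by rewrite /= scaleN1r lerN2.
split; first exact: average_scalar.
pose C := (fine (m A))^-1 * (fine (m A) + 1).
have C0 : 0 < C by rewrite mulr_gt0 ?invr_gt0 ?ltr_wpDl// ltW.
have unit_le (x : Lp) : `|x| = 1 -> `|average x| <= C.
  move=> x1; rewrite /average normrM ger0_norm ?invr_ge0 ?(ltW a_gt0)//.
  rewrite ler_pM2l ?invr_gt0//.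
  apply: le_trans (le_normr_Rintegral mA (Lspace_integrable_finite x)) _.
  apply: (@le_trans _ _ (\int[m]_(t in A) (1 + `|x t| `^ p))).
    apply: le_Rintegral => //; first exact: integrable_norm (Lspace_integrable_finite x).
    by move=> t _; exact: norm_le1D_powR.
  rewrite RintegralD//; last 2 first.
    exact: integrable_cst_lty.
    exact: integrableS (Lspace_integrable_powR x).
  rewrite Rintegral_cst// mul1r lerD2l -lee_fin.
  have ix := integrableS measurableT mA (@subsetT _ _) (Lspace_integrable_powR x).
  rewrite /Rintegral fineK; last exact: (integrable_fin_num _ ix).
  apply: (@le_trans _ _ (\int[m]_t (`|x t| `^ p)%:E)%E).
    apply: ge0_subset_integral => //.
      by case/integrableP : (Lspace_integrable_powR x).
  by rewrite Lspace_norm_powR x1 powR1.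
exists C => // x.
have [->|x0] := eqVneq x 0.
  by have := averageZ 0 0; rewrite scale0r mul0r => ->; rewrite !normr0 mulr0.
have nx0 : 0 < `|x| by rewrite normr_gt0.
have := unit_le (`|x|^-1 *: x).
rewrite normrZ normfV normr_id mulVf ?gt_eqF// => /(_ erefl).
rewrite averageZ normrM normfV normr_id ler_pdivrMl// mulrC//.
Qed.

End average.


(** Almost everywhere reasoning for a measure whose carrier unfolds to a type
    with other structures, such as [R]: here the filter is determined by the
    measurable structure [T]. *)
Lemma ae_imply d (T : measurableType d) (R : realType)
    (mu : {measure set T -> \bar R}) (P Q : T -> Prop) :
  (forall x, P x -> Q x) -> {ae mu, forall x, P x} -> {ae mu, forall x, Q x}.
Proof. by move=> PQ; exact: filterS. Qed.

Lemma ae_imply2 d (T : measurableType d) (R : realType)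
    (mu : {measure set T -> \bar R}) (P Q U : T -> Prop) :
  (forall x, P x -> Q x -> U x) -> {ae mu, forall x, P x} ->
  {ae mu, forall x, Q x} -> {ae mu, forall x, U x}.
Proof. by move=> PQU; exact: filterS2. Qed.

(** * Mild solutions tested against a functional *)
Section mild_solution.
Context (R : realType) (X : ptopologicalType).
Variables (m : {measure set (borelType X) -> \bar R}).
Variables (p : R) (p1 : (1 <= p%:E)%E).
Local Notation Lp := (LspaceType m p1).
Local Notation leb := (@lebesgue_measure R).
Variable S : R -> Lp -> Lp.
Hypotheses (S_C0 : C0_semigroup S) (S_markov : sub_markovian S).

Lemma sub_markov_semigroup (l : Lp -> R) (t : R) : 0 <= t ->
  sub_markov_functional l -> sub_markov_functional (l \o S t).
Proof.
move=> t0 sl; split; last first.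
  move=> x x01; apply: (sub_markov_unit sl).
  move: t0; rewrite le_eqVlt => /predU1P[<-|t0]; last exact: S_markov.
  by rewrite (C0_id S_C0).
have bl := sub_markov_bounded sl.
split => [c x y|].
  by rewrite /= (C0_linear S_C0 t0) bounded_functionalD// bounded_functionalZ.
have [K K0 lK] := bounded_functional_le bl.
have [M SM] := C0_bounded S_C0 t0.
exists (K * (`|M| + 1)); first by rewrite mulr_gt0// ltr_wpDl.
move=> x; rewrite (le_trans (lK _))// -mulrA ler_pM2l// (le_trans (SM _))//.
by rewrite ler_wpM2r// (le_trans (ler_norm _))// lerDl.
Qed.

Lemma comp_opE (f : R -> R) (x : Lp) :
  comp_dom f x -> (comp_op f x : X -> R) = f \o x %[ae m].
Proof. move=> [_ [y yE]]; rewrite /comp_op.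
by case: xgetP => [z _ //|/(_ y)/(_ yE)].
 Qed.

(** Applying [l \o S (T - t)] to the mild equation at time [t] turns the
    integrand [S (t - s) (f (u s))] into [S (T - s) (f (u s))], which does not
    depend on [t]. A single measurable function [h], obtained at [t = T],
    therefore serves for all [t]. *)
Lemma mild_solution_functional (f : R -> R) (a : Lp) (I : set R) (u : R -> Lp)
    (T : R) (l : Lp -> R) :
  0 < T -> (forall t, 0 <= t <= T -> I t) -> mild_solution S f a I u ->
  sub_markov_functional l ->
  exists2 h : R -> R,
    {ae leb, forall s, `]0, T]%classic s -> h s = l (S (T - s) (comp_op f (u s)))} &
    leb.-integrable `]0, T] (EFin \o h) /\
    forall t, 0 < t <= T ->
      l (S (T - t) (u t)) = l (S T a) + \int[leb]_(s in `]0, t]) h s.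
Proof.
move=> T0 IT [_ _ _ u_mild] sl.
have TT : 0 <= T <= T by rewrite ltW/=.
have [vT iT uT] := u_mild T (IT _ TT).
have bl := sub_markov_bounded sl.
have [|h mh hE] := strongly_measurable_functional bl _ iT.1; first by [].
exists h => //.
have key t : 0 < t <= T -> leb.-integrable `]0, t] (EFin \o h) /\
    l (S (T - t) (u t)) = l (S T a) + \int[leb]_(s in `]0, t]) h s.
  move=> /andP[t0 tT].
  have [|v it ->] := u_mild t (IT _ _); first by rewrite (ltW t0).
  have Tt0 : 0 <= T - t by rewrite subr_ge0.
  have slt := sub_markov_semigroup Tt0 sl.
  have blt := sub_markov_bounded slt.
  have sub_tT : `]0, t]%classic `<=` `]0, T].
    by apply: subset_itvl; rewrite bnd_simp.
  have [|||ih ->] := bochner_integral_functional blt _ it (h := h); first by [].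
  - exact: measurable_funS mh.
  - apply: filterS hE => s hs st.
    rewrite (hs (sub_tT _ st))/= -(C0_add S_C0)//.
      by rewrite addrA subrK.
    by move: st; rewrite /= in_itv/= subr_ge0 => /andP[].
  split=> //.
  rewrite -[LHS]/((l \o S (T - t)) (S t a + v)) (bounded_functionalD blt)/=.
  by rewrite -(C0_add S_C0) ?(ltW t0)// subrK.
split=> [|t /key[]//].
by case: (key T) => //; rewrite T0 lexx.
Qed.

(** The function [y t := l (S T a) + \int_(]0, t]) h] is a supersolution of
    [y' = f y]. First [h >= 0] shows that [y] is nondecreasing and positive; then
    Jensen's inequality gives [h r >= f (y r) >= f (y s)] for [s < r], and
    integrating from [s] to [t] yields the inequality that
    [supersolution_time_le] requires. *)
Lemma mild_solution_time_le (f : R -> R) (a : Lp) (I : set R) (u : R -> Lp)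
    (T : R) (l : Lp -> R) :
  convex_function (`[0, +oo[ : set R^o) f ->
  {within `[0, +oo[, continuous f} ->
  f 0 = 0 ->
  (forall s, 0 < s -> 0 < f s) ->
  (\int[leb]_(s in `[1%R, +oo[) ((f s)^-1)%:E < +oo)%E ->
  0 < T -> (forall t, 0 <= t <= T -> I t) -> mild_solution S f a I u ->
  sub_markov_functional l -> 0 < l (S T a) ->
  T <= tail_integral f (l (S T a)).
Proof.
move=> f_convex f_cont f0 f_gt0 f_tail T0 IT u_mild sl lSTa.
have f_ge0 r : 0 <= r -> 0 <= f r.
  by rewrite le_eqVlt => /predU1P[<-|/f_gt0/ltW//]; rewrite f0.
have f_nd := convex_nondecreasing f_convex f0 f_ge0.
have [h hE [ih lu]] := mild_solution_functional T0 IT u_mild sl.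
have [_ u_dom _ _] := u_mild.
pose y t := l (S T a) + \int[leb]_(s in `]0, t]) h s.
have y0 : y 0 = l (S T a) by rewrite /y set_itvoc0 Rintegral_set0 addr0.
have h_growth s t c : 0 <= s -> s < t -> t <= T ->
    {ae leb, forall r, `]s, t]%classic r -> c <= h r} -> y s + (t - s) * c <= y t.
  move=> s0 st tT ch.
  have sub r : `]s, t]%classic r -> `]0, T]%classic r.
    rewrite /= !in_itv/= => /andP[sr rt].
    by rewrite (le_lt_trans s0 sr) (le_trans rt tT).
  have i0t : leb.-integrable `]0, t] (EFin \o h).
    by apply: integrableS ih => //; apply: subset_itvl; rewrite bnd_simp.
  have ist : leb.-integrable `]s, t] (EFin \o h) by exact: integrableS ih.
  rewrite /y -addrA lerD2l -lerBrDl Rintegral_itvB// ?bnd_simp//; last exact: ltW.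
  have st_lty : (leb `]s, t]%classic < +oo)%E.
    by rewrite /= lebesgue_measure_itv/= lte_fin st -EFinD ltry.
  have mst : measurable (`]s, t]%classic : set (measurableTypeR R)) by [].
  have := Rintegral_ae_ge mst st_lty ist ch.
  by rewrite /= lebesgue_measure_itv/= lte_fin st -EFinD /= mulrC.
have N_dom s : 0 < s <= T -> comp_dom f (u s).
  by move=> /andP[s0 sT]; apply: u_dom; [apply: IT; rewrite (ltW s0)|rewrite gt_eqF].
have h_ge0 : {ae leb, forall r, `]0, T]%classic r -> 0 <= h r}.
  apply: ae_imply hE => r hr rT; rewrite (hr rT).
  have rT' : 0 < r <= T by move: rT; rewrite /= in_itv.
  have Tr0 : 0 <= T - r by rewrite subr_ge0; case/andP: rT'.
  apply: (sub_markov_ge0 (sub_markov_semigroup Tr0 sl)).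
  have dom := N_dom _ rT'.
  apply: ae_imply2 (comp_opE dom) dom.1 => x /(_ Logic.I) -> ux.
  exact: f_ge0.
have y_nd s t : 0 <= s -> s < t -> t <= T -> y s <= y t.
  move=> s0 st tT; rewrite -[leLHS]addr0 -(mulr0 (t - s)).
  apply: h_growth => //; apply: ae_imply h_ge0 => r hr.
  rewrite /= in_itv/= => /andP[sr rt].
  by apply: hr; rewrite /= in_itv/= (le_lt_trans s0 sr) (le_trans rt tT).
have y_gt0 t : 0 <= t -> t <= T -> 0 < y t.
  rewrite le_eqVlt => /predU1P[<- _|t0 tT]; first by rewrite y0.
  by apply: lt_le_trans (y_nd 0 t (lexx 0) t0 tT); rewrite y0.
have hf : {ae leb, forall r, `]0, T]%classic r -> f (y r) <= h r}.
  apply: ae_imply hE => r hr rT; rewrite (hr rT).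
  have rT' : 0 < r <= T by move: rT; rewrite /= in_itv.
  have [r0 r_le] := andP rT'.
  have Tr0 : 0 <= T - r by rewrite subr_ge0.
  have yr0 := y_gt0 r (ltW r0) r_le.
  have dom := N_dom _ rT'.
  have yE : y r = (l \o S (T - r)) (u r) by rewrite /= lu.
  rewrite yE in yr0 *.
  exact: (sub_markov_jensen (sub_markov_semigroup Tr0 sl) f_convex f0 dom.1
    (comp_opE dom)).
rewrite -y0; apply: (supersolution_time_le f_nd f_cont f_gt0 f_tail T0).
  by rewrite y0.
move=> s t s0 st tT; apply: h_growth => //.
apply: ae_imply hf => r hr; rewrite /= in_itv/= => /andP[sr rt].
have r0 := le_lt_trans s0 sr; have rT := le_trans rt tT.
apply: le_trans (hr _); last by rewrite /= in_itv/= r0.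
apply: f_nd; last exact: y_nd.
by apply/ltW/y_gt0 => //; exact: le_trans (ltW st) tT.
Qed.

End mild_solution.

(** Otherwise every piece [U `&` F n] of [U] along an exhaustion [F] would be
    null, and so would be [U]. *)
Lemma sigma_finite_positive_subset d (T : measurableType d) (R : realType)
    (mu : {measure set T -> \bar R}) (U : set T) :
  sigma_finite setT mu -> measurable U -> (0 < mu U)%E ->
  exists A, [/\ measurable A, A `<=` U, (0 < mu A)%E & (mu A < +oo)%E].
Proof.
move=> [F FT Ffin] mU U0; apply: contrapT => noA.
have UF n : mu (U `&` F n) = 0%E.
  have [mF Foo] := Ffin n.
  have mUF := measurableI _ _ mU mF.
  apply/eqP; rewrite eq_le measure_ge0 andbT leNgt; apply/negP => UF0.
  apply: noA; exists (U `&` F n); split => //.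
  by apply: le_lt_trans Foo; apply: le_measure; rewrite ?inE.
suff : mu U = 0%E by move=> U0'; rewrite U0' ltxx in U0.
have -> : U = \bigcup_n (U `&` F n) by rewrite -setI_bigcupr -FT setIT.
apply/eqP; rewrite eq_le measure_ge0 andbT.
apply: le_trans (measure_sigma_subadditive _ _ _ (@subset_refl _ _)) _.
- by move=> n; apply: measurableI => //; case: (Ffin n).
- by apply: bigcupT_measurable => n; apply: measurableI => //; case: (Ffin n).
- by rewrite eseries0.
Qed.

(** * Non-existence of global mild solutions *)
Theorem corollary4p5 (R : realType) (X : ptopologicalType)
  (m : {measure set (borelType X) -> \bar R})
  (p : R) (p1 : (1 <= p%:E)%E)
  (S : R -> LspaceType m p1 -> LspaceType m p1)
  (D : set (LspaceType m p1)) (L : LspaceType m p1 -> LspaceType m p1)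
  (f : R -> R) (a : LspaceType m p1) (T : R) (xi : X) :
  hausdorff_space X ->
  sigma_finite [set: borelType X] m ->
  full_support m ->
  C0_semigroup S ->
  is_generator S D L ->
  sub_markovian S ->
  (forall (phi : LspaceType m p1) (t : R), 0 < t ->
    exists g : X -> R, is_continuous_repr (S t phi) g) ->
  (forall s : R, 0 <= s -> 0 <= f s) ->
  convex_function (`[0, +oo[ : set R^o) f ->
  {within `[0, +oo[, continuous f} ->
  f 0 = 0 ->
  (forall s : R, 0 < s -> 0 < f s) ->
  (\int[lebesgue_measure]_(s in `[1%R, +oo[) ((f s)^-1)%:E < +oo)%E ->
  Lp_plus a ->
  0 < T ->
  continuous_repr (S T a) xi > tail_integral_inv f T ->
  ~ (exists u : R -> LspaceType m p1, mild_solution S f a `[0, +oo[ u) /\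
  (forall (I : set R) (u : R -> LspaceType m p1),
    is_interval I -> I `<=` `[0, +oo[ -> I 0 ->
    mild_solution S f a I u ->
    (ereal_sup (EFin @` I) <= T%:E)%E).
Proof.
move=> _ m_sfin m_supp S_C0 _ S_markov S_cont f_ge0 f_convex f_cont f0 f_gt0.
move=> f_tail _ T0 xi_gt.
suff no_mild (I : set R) u : (forall t, 0 <= t <= T -> I t) ->
    ~ mild_solution S f a I u.
  split=> [[u]|I u I_itv _ I0 u_mild].
    by apply: no_mild => t /andP[t0 _]; rewrite /= in_itv/= t0.
  apply: ge_ereal_sup => _ [t It <-]; rewrite lee_fin leNgt; apply/negP => Tt.
  apply: (no_mild I u _ u_mild) => r /andP[r0 rT].
  by apply: (I_itv _ _ I0 It); rewrite r0 (le_trans rT (ltW Tt)).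
move=> IT u_mild.
set c := tail_integral_inv f T in xi_gt.
have [g_cont gE] : is_continuous_repr (S T a) (continuous_repr (S T a)).
  rewrite /continuous_repr; case: xgetP => [g _ //|no_g].
  by have [g /no_g] := S_cont a T T0.
set g := continuous_repr (S T a) in xi_gt g_cont gE.
have [c' cc' c'xi] : exists2 c', c < c' & c' < g xi.
  by exists ((c + g xi) / 2); rewrite (midf_lt xi_gt).
pose U : set X := [set x | c' < g x].
have openU : open U.
  by apply: (open_comp (D := [set r | c' < r])) => [x _|]; [exact: g_cont|exact: open_gt].
have mU : measurable (U : set (borelType X)) by exact: sub_sigma_algebra.
have U_gt0 : (0 < m U)%E by apply: m_supp => //; exists xi.
have [A [mA AU A_gt0 A_lty]] := sigma_finite_positive_subset m_sfin mU U_gt0.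
pose l := average m A : LspaceType m p1 -> R.
have sl : sub_markov_functional l by exact: average_sub_markov.
have f_nd := convex_nondecreasing f_convex f0 f_ge0.
have c_ge0 : 0 <= c by exact: tail_integral_inv_ge0.
have c_lt : c < l (S T a).
  apply: (lt_le_trans cc'); apply: average_ge => //.
  by apply: ae_imply gE => x /(_ Logic.I) <- /AU /ltW.
have l_gt0 : 0 < l (S T a) by exact: le_lt_trans c_lt.
have TF := mild_solution_time_le S_C0 S_markov f_convex f_cont f0 f_gt0 f_tail
  T0 IT u_mild sl l_gt0.
have [c_gt0 cT] := tail_integralK f_nd f_cont f_gt0 f_tail l_gt0 T0 TF.
have := tail_integralB_ge f_nd f_cont f_gt0 f_tail c_gt0 (ltW c_lt).
rewrite cT leNgt => /negP; apply.
apply: (@le_lt_trans _ _ 0); first by rewrite subr_le0.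
by rewrite divr_gt0 ?subr_gt0// f_gt0.
Qed.
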